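(* Let $f_1,\dots,f_m:\mathbb{R}^n\to\mathbb{R}$ be differentiable functions whose gradients are $L$-Lipschitz continuous for some $L\ge 0$. Let $(\alpha_k)_{k\ge 1}$ be real numbers with $\alpha_k>0$ for all $k$, $\lim_{k\to\infty}\alpha_k=0$ and $\sum_{k\ge 1}\alpha_k=\infty$. Run the incremental central descent algorithm (defined in the context) with these step-sizes from an arbitrary initial point $\hat{x}_1\in\mathbb{R}^n$ and arbitrary initial non-null vectors $\hat g_1,\dots,\hat g_m\in\mathbb{R}^n\setminus\{0\}$, and suppose that it does not stop, so that it generates an infinite sequence $(\hat{x}_k)_{k\ge1}$. Then there is a subsequence $(\hat{x}_{k_j})_{j\ge 1}$ such that at least one of the following holds: (i) $\lim_{j\to\infty}\|\nabla f_i(\hat{x}_{k_j})\|=0$ for some $i\in\{1,\dots,m\}$; or (ii) $\|V_c(\hat{x}_{k_j})\|\to\infty$ as $j\to\infty$; or (iii) $\lim_{j\to\infty} f_i(\hat{x}_{k_j})=-\infty$ for all $i\in\{1,\dots,m\}$ (in particular all the functions are unbounded from below).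
   Context: $\|\cdot\|$ is the Euclidean norm. $L$-Lipschitz gradients means $\|\nabla f_i(x)-\nabla f_i(y)\|\le L\|x-y\|$ for all $x,y\in\mathbb{R}^n$ and all $i=1,\dots,m$. Central descent direction: for $x\in\mathbb{R}^n$, $V_c(x)$ is the unique minimizer of $\tfrac12\|V\|^2$ over all $V\in\mathbb{R}^n$ satisfying $\nabla f_i(x)^T V\le -\|\nabla f_i(x)\|$ for all $i=1,\dots,m$. If no such $V$ exists, $V_c(x)$ is said to be empty, and we use the convention $\|V_c(x)\|=+\infty$. Incremental central descent algorithm: it maintains a point $\hat x\in\mathbb{R}^n$, vectors $\hat g_1,\dots,\hat g_m\in\mathbb{R}^n$ (estimates of the gradients), and an index $t\in\{1,\dots,m\}$, initially $t=1$. At iteration $k=1,2,\dots$, with current point $\hat{x}_k$: 1. Replace $\hat g_t$ by $\nabla f_t(\hat{x}_k)$ (the other $\hat g_i$ are kept unchanged); if the new $\hat g_t$ is null, stop. 2. Let $\hat V_k$ be the minimizer of $\|V\|^2$ over all $V\in\mathbb{R}^n$ with $\hat g_i^T V\le -\|\hat g_i\|$ for all $i=1,\dots,m$; if no such $V$ exists, stop. 3. Set $\hat{x}_{k+1}=\hat{x}_k+\alpha_k\,\hat V_k/\|\hat V_k\|$, and replace $t$ by its cyclic successor in $\{1,\dots,m\}$ (that is, $t+1$ if $t<m$, and $1$ if $t=m$). *)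

(* Defs.v *)
From HB Require Import structures.
From mathcomp Require Import all_boot all_order all_algebra.
From mathcomp Require Import all_classical all_reals all_analysis.

Set Implicit Arguments.
Unset Strict Implicit.
Unset Printing Implicit Defensive.

Import Order.TTheory GRing.Theory Num.Theory.
Import numFieldNormedType.Exports.

Local Open Scope classical_set_scope.
Local Open Scope ring_scope.

Definition dotp (R : realType) (n : nat) (u v : 'rV[R]_n) : R :=
  \sum_(j < n) u 0 j * v 0 j.

(* The library norm `|u| on 'rV[R]_n is the sup norm, hence this definition.
   Both norms induce the same topology and the same notion of
   differentiability. *)
Definition enorm (R : realType) (n : nat) (u : 'rV[R]_n) : R :=
  Num.sqrt (dotp u u).

Definition grad (R : realType) (n : nat) (f : 'rV[R]_n -> R) (x : 'rV[R]_n) :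
    'rV[R]_n :=
  \row_(j < n) 'D_(delta_mx 0 j) f x.

Definition is_minimizer (R : realType) (T : Type) (phi : T -> R) (A : set T)
    (v : T) : Prop :=
  A v /\ forall w, A w -> phi v <= phi w.

Definition central_cone (R : realType) (n m : nat) (g : 'I_m -> 'rV[R]_n) :
    set 'rV[R]_n :=
  [set V | forall i, dotp (g i) V <= - enorm (g i)].

(* None encodes an empty V_c(x).  When the feasible set is nonempty, it is
   closed and convex, so the minimizer selected by xget exists and is unique,
   and the default value 0 is not used. *)
Definition central_dir (R : realType) (n m : nat) (f : 'I_m -> 'rV[R]_n -> R)
    (x : 'rV[R]_n) : option 'rV[R]_n :=
  let A := central_cone (fun i => grad (f i) x) in
  if `[< A !=set0 >]
  then Some (xget 0 (is_minimizer (fun V => 2^-1 * enorm V ^+ 2) A))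
  else None.

Definition central_dir_norm (R : realType) (n m : nat)
    (f : 'I_m -> 'rV[R]_n -> R) (x : 'rV[R]_n) : \bar R :=
  if central_dir f x is Some V then (enorm V)%:E else +oo%E.

(* x is an infinite run of the incremental central descent algorithm from the
   point x1 and the estimates g1.  Indices are shifted by one: x k, alpha k, V k
   belong to iteration k.+1, and f_1 is the function of index 0.  g k and t k
   are the estimates and the index at the start of that iteration, so g k.+1 is
   the family after the replacement of the t k-th estimate.  The two tests of
   non-stopping are g k.+1 (t k) != 0 and the existence of the minimizer V k. *)
Definition incremental_central_run (R : realType) (n m : nat)
    (f : 'I_m -> 'rV[R]_n -> R) (alpha : nat -> R)
    (x1 : 'rV[R]_n) (g1 : 'I_m -> 'rV[R]_n) (x : nat -> 'rV[R]_n) : Prop :=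
  exists (g : nat -> 'I_m -> 'rV[R]_n) (t : nat -> 'I_m) (V : nat -> 'rV[R]_n),
    [/\ x 0%N = x1, (forall i, g 0%N i = g1 i), t 0%N = 0%N :> nat &
      forall k : nat,
        [/\ forall i, g k.+1 i = if i == t k then grad (f i) (x k) else g k i,
            g k.+1 (t k) != 0,
            is_minimizer (fun W => enorm W ^+ 2) (central_cone (g k.+1)) (V k),
            x k.+1 = x k + (alpha k / enorm (V k)) *: V k &
            t k.+1 = ordS (t k)]].

(* Main.v *)
Require Import Defs.
From HB Require Import structures.
From mathcomp Require Import all_boot all_order all_algebra.
From mathcomp Require Import all_classical all_reals all_analysis.
From mathcomp Require Import ring lra.

Set Implicit Arguments.
Unset Strict Implicit.
Unset Printing Implicit Defensive.

Import Order.TTheory GRing.Theory Num.Theory.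
Import numFieldNormedType.Exports.

Local Open Scope classical_set_scope.
Local Open Scope ring_scope.

(** The argument negates (i) and (ii) to get (iii).  If no subsequence makes a
    gradient vanish and no subsequence makes the central direction blow up, then
    from some iteration on every gradient has norm at least some eps_i > 0, and
    every V_c(x_k) exists with norm at most a fixed M >= 1.  In that case (iii)
    holds along the whole sequence.

    - Each iteration moves the point by exactly alpha_k, and each estimate is
      refreshed at least once in any 2m consecutive iterations.  The stale
      estimate of the i-th gradient is therefore off by at most L times the sum
      of the last 2m steps, which tends to 0 ([estimate_error_vanishes]).

    - Doubling the exact central direction leaves a margin of one gradient norm
      in each of its constraints.  Once the errors are small compared with
      eps_i / M, this margin absorbs them, so 2 V_c(x_k) is feasible for the
      stale problem and the computed direction has norm at most 2 M
      ([stale_minimizer_bounded]).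

    - A step of length alpha_k along a direction V with g.V <= -|g| and
      |V| <= 2 M has slope at most -|g| / (2 M) with respect to g.  Both the
      error on g and the second order term L alpha_k^2 are eventually a small
      fraction of this, so f_i decreases by at least c_i alpha_k with
      c_i = eps_i / (8 M) ([stale_step_decreases]).

    The alpha_k have a divergent sum, so every f_i tends to -oo along the run
    ([cvgNy_of_step_decrease]). *)

(** * Euclidean inner product and norm *)

Section EuclideanNorm.
Variables (R : realType) (n : nat).
Implicit Types u v w : 'rV[R]_n.

Lemma dotpC u v : dotp u v = dotp v u.
Proof. by apply: eq_bigr => j _; rewrite mulrC. Qed.

Lemma dotpDl u v w : dotp (u + v) w = dotp u w + dotp v w.
Proof. by rewrite -big_split; apply: eq_bigr => j _; rewrite mxE mulrDl. Qed.

Lemma dotpZl (a : R) u v : dotp (a *: u) v = a * dotp u v.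
Proof. by rewrite mulr_sumr; apply: eq_bigr => j _; rewrite mxE mulrA. Qed.

Lemma dotpBl u v w : dotp (u - v) w = dotp u w - dotp v w.
Proof. by rewrite dotpDl -scaleN1r dotpZl mulN1r. Qed.

Lemma dotpDr u v w : dotp w (u + v) = dotp w u + dotp w v.
Proof. by rewrite ![dotp w _]dotpC dotpDl. Qed.

Lemma dotpZr (a : R) u v : dotp u (a *: v) = a * dotp u v.
Proof. by rewrite ![dotp u _]dotpC dotpZl. Qed.

Lemma dotpBr u v w : dotp w (u - v) = dotp w u - dotp w v.
Proof. by rewrite ![dotp w _]dotpC dotpBl. Qed.

Lemma dotpp_ge0 u : 0 <= dotp u u.
Proof. by apply: sumr_ge0 => j _; rewrite -expr2 sqr_ge0. Qed.

Lemma enorm_ge0 u : 0 <= enorm u.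
Proof. exact: sqrtr_ge0. Qed.

Lemma enorm_sqr u : enorm u ^+ 2 = dotp u u.
Proof. by rewrite sqr_sqrtr ?dotpp_ge0. Qed.

Lemma enorm_gt0 u : (0 < enorm u) = (u != 0).
Proof.
rewrite sqrtr_gt0 lt_neqAle dotpp_ge0 andbT eq_sym; congr (~~ _).
apply/eqP/eqP => [u0 | ->]; last by rewrite -(scale0r 0) dotpZl mul0r.
apply/rowP => j; rewrite mxE; apply/eqP; rewrite -sqrf_eq0 expr2; apply/eqP.
by apply: (psumr_eq0P _ u0) => // i _; rewrite -expr2 sqr_ge0.
Qed.

(** Cauchy-Schwarz, from the nonnegativity of the squared norm of
    |v| u - |u| v. *)
Lemma dotp_le_enorm u v : dotp u v <= enorm u * enorm v.
Proof.
have [->|] := eqVneq u 0.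
  by rewrite -{1}(scale0r 0) dotpZl mul0r mulr_ge0 ?enorm_ge0.
rewrite -enorm_gt0 => u0.
have [->|] := eqVneq v 0.
  by rewrite -{1}(scale0r 0) dotpZr mul0r mulr_ge0 ?enorm_ge0.
rewrite -enorm_gt0 => v0.
have := dotpp_ge0 (enorm v *: u - enorm u *: v).
rewrite !(dotpBl, dotpBr, dotpZl, dotpZr) -!enorm_sqr [dotp v u]dotpC => H.
rewrite -(ler_pM2l (mulr_gt0 u0 v0)); nra.
Qed.

Lemma enormZ (a : R) u : enorm (a *: u) = `|a| * enorm u.
Proof.
by rewrite /enorm dotpZl dotpZr mulrA -expr2 sqrtrM ?sqr_ge0 // sqrtr_sqr.
Qed.

Lemma ler_enormD u v : enorm (u + v) <= enorm u + enorm v.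
Proof.
rewrite -(ler_pXn2r (ltn0Sn 1)) ?nnegrE ?addr_ge0 ?enorm_ge0 //.
rewrite enorm_sqr !(dotpDl, dotpDr) -!enorm_sqr [dotp v u]dotpC.
by have := dotp_le_enorm u v; nra.
Qed.

Lemma enormB u v : enorm (u - v) = enorm (v - u).
Proof. by rewrite -opprB -scaleN1r enormZ normrN1 mul1r. Qed.

Lemma normr_coord_le u j : `|u 0 j| <= enorm u.
Proof.
rewrite -sqrtr_sqr ler_sqrt ?dotpp_ge0 // /dotp (bigD1 j) //= expr2 lerDl.
by apply: sumr_ge0 => i _; rewrite -expr2 sqr_ge0.
Qed.

Lemma dotp_continuous (T : topologicalType) (a b : T -> 'rV[R]_n) :
  continuous a -> continuous b -> continuous (fun z => dotp (a z) (b z)).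
Proof.
move=> ca cb.
have -> : (fun z => dotp (a z) (b z)) =
    \sum_(j < n) (fun z => a z 0 j * b z 0 j).
  by apply/funext => z; rewrite fct_sumE.
have coord (c : T -> 'rV[R]_n) j : continuous c -> continuous (fun z => c z 0 j).
  move=> cc z; apply: (@continuous_comp _ _ _ c (fun w : 'rV[R]_n => w 0 j)).
    exact: cc.
  exact: coord_continuous.
elim/big_ind: _ => [z | h1 h2 c1 c2 z | j _ z].
- exact: cvg_cst.
- by apply: cvgD; [exact: c1 | exact: c2].
- by apply: cvgM; exact: coord.
Qed.

End EuclideanNorm.

(** * Existence of central directions *)

Section CentralCone.
Variables (R : realType) (n m : nat).

(** The cone is closed, and cutting it by the ball through any of its points
    keeps it nonempty and makes it compact without excluding a minimizer. *)
Lemma central_cone_has_minimizer (g : 'I_m -> 'rV[R]_n) :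
  central_cone g !=set0 ->
  exists v, is_minimizer (fun V => 2^-1 * enorm V ^+ 2) (central_cone g) v.
Proof.
move=> [W gW].
have sqc : continuous (fun V : 'rV[R]_n => enorm V ^+ 2).
  under [fun V => _]eq_fun do rewrite enorm_sqr.
  by apply: dotp_continuous => V; exact: cvg_id.
pose A := central_cone g `&` [set V | enorm V ^+ 2 <= enorm W ^+ 2].
have cA : closed A.
  apply: closedI; last first.
    apply: (preimage_closed (f := fun V : 'rV[R]_n => enorm V ^+ 2)
      (D := [set r | r <= enorm W ^+ 2])).
      by move=> V _; exact: sqc.
    exact: closed_le.
  have -> : central_cone g =
      \bigcap_(i in [set: 'I_m]) [set V | dotp (g i) V <= - enorm (g i)].
    by apply/seteqP; split=> V /= h i; [move=> _; exact: h | exact: h].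
  apply: closed_bigI => i _.
  apply: (preimage_closed (f := dotp (g i)) (D := [set r | r <= - enorm (g i)])).
    move=> V _; apply: dotp_continuous; first exact: cst_continuous.
    by move=> z; exact: cvg_id.
  exact: closed_le.
have bA : bounded_set A.
  exists (enorm W); split; first exact: num_real.
  move=> M WM V [_ /= VW].
  have {}VW : enorm V <= enorm W.
    by rewrite -(ler_pXn2r (ltn0Sn 1)) ?nnegrE ?enorm_ge0.
  rewrite [`|V|]mx_normrE; apply: bigmax_le => [|[i j] _].
    exact: le_trans (enorm_ge0 W) (ltW WM).
  rewrite ord1; apply: le_trans (normr_coord_le V j) _.
  exact: le_trans VW (ltW WM).
have A0 : A !=set0 by exists W; split => /=.
have [v] := EVT_min_rV A0 (bounded_closed_compact bA cA)
    (continuous_subspaceT sqc).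
rewrite inE => -[gv /= vW] vmin; exists v; split=> // V gV.
rewrite ler_pM2l ?invr_gt0 ?ltr0n //.
have [VW|/ltW] := lerP (enorm V ^+ 2) (enorm W ^+ 2).
  by apply: vmin; rewrite inE.
exact: le_trans.
Qed.

(** Existence of the minimizer is what rules out that a small value of
    [central_dir_norm] comes from the default vector of [xget]. *)
Lemma central_dir_norm_feasible (f : 'I_m -> 'rV[R]_n -> R) x (M : R) :
  (central_dir_norm f x <= M%:E)%E ->
  exists2 W, central_cone (fun i => grad (f i) x) W & enorm W <= M.
Proof.
rewrite /central_dir_norm /central_dir; case: asboolP => //= /[dup] ne.
move=> /central_cone_has_minimizer; case: xgetP => [v _ [gv _] _|no [v]].
  by rewrite lee_fin => vM; exists v.
by move/no.
Qed.

End CentralCone.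

(** * First order expansion with Lipschitz gradient *)

Section LineDescent.
Variables (R : realType) (n : nat) (f : 'rV[R]_n -> R).
Hypothesis f_diff : forall y, differentiable f y.

Lemma derive_dotp_grad z s : 'D_s f z = dotp (grad f z) s.
Proof.
rewrite deriveE // {1}[s]row_sum_delta linear_sum; apply: eq_bigr => j _.
by rewrite linearZ /= mxE deriveE // mulrC.
Qed.

(** By the mean value theorem the increment is the slope along s at an
    intermediate point, whose gradient is within L |s| of the gradient at y.
    The constant L, instead of the optimal L / 2, avoids integrating. *)
Lemma lipschitz_grad_step (L : R) :
  (forall y z, enorm (grad f y - grad f z) <= L * enorm (y - z)) -> 0 <= L ->
  forall y s, f (y + s) <= f y + dotp (grad f y) s + L * enorm s ^+ 2.
Proof.
move=> lip L0 y s.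
pose h (r : R) := f (y + r *: s).
(* The difference quotients of h at r are those of f at y + r s along s. *)
have dh (r : R) : is_derive r 1 h (dotp (grad f (y + r *: s)) s).
  have E : (fun e : R => e^-1 *: ((h \o shift r) (e *: 1) - h r)) =
      (fun e => e^-1 *: ((f \o shift (y + r *: s)) (e *: s) - f (y + r *: s))).
    apply/funext => e; congr (_ *: (f _ - _)).
    by rewrite /= scalerDl scaler1 addrCA.
  rewrite -derive_dotp_grad; apply: DeriveDef.
    by rewrite /derivable E; exact: diff_derivable.
  by rewrite /derive E.
have [|c /[!in_itv]/= /andP[c0 c1]] := @MVT_segment R h _ 0 1 ler01
    (fun r _ => dh r).
  apply: derivable_within_continuous => r _; exact: ex_derive.
rewrite /h scale1r scale0r addr0 subr0 mulr1 => E.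
have : dotp (grad f (y + c *: s) - grad f y) s <= L * enorm s ^+ 2.
  apply: le_trans (dotp_le_enorm _ _) _; rewrite expr2 mulrA.
  rewrite ler_wpM2r ?enorm_ge0 //; apply: le_trans (lip _ _) _.
  rewrite addrC addKr enormZ ger0_norm // ler_wpM2l //.
  by rewrite ler_piMl ?enorm_ge0.
by rewrite dotpBl -E; lra.
Qed.

End LineDescent.

(** * Subsequences and divergence of real sequences *)

Section Sequences.

Lemma extract_subsequence (P : nat -> nat -> Prop) :
  (forall j N, exists2 k, (N <= k)%N & P j k) ->
  exists2 kk, increasing_seq kk & forall j, P j (kk j).
Proof.
move=> H.
have /choice[h hP] (jN : nat * nat) :
    exists k, (jN.2 <= k)%N /\ P jN.1 k.
  by case: jN => j N; have [k] := H j N; exists k.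
pose kk := fix kk j := if j is j'.+1 then h (j, (kk j').+1) else h (0, 0)%N.
exists kk; last first.
  by case=> [|j]; [exact: (hP (0, 0)%N).2 | exact: (hP (j.+1, (kk j).+1)).2].
by apply/increasing_seqP => j; exact: (hP (j.+1, (kk j).+1)).1.
Qed.

Lemma eventually_ge_of_not_subseq_cvg0 (R : realType) (u : nat -> R) :
  (forall k, 0 <= u k) ->
  (forall kk, increasing_seq kk -> ~ (u (kk j) @[j --> \oo] --> 0)) ->
  exists2 eps, 0 < eps & \forall k \near \oo, eps <= u k.
Proof.
move=> u0 nocvg; apply: contrapT => nolb.
have [j N|kk kk_incr kk_small] :=
    @extract_subsequence (fun j k => u k < j.+1%:R^-1).
  apply: contrapT => noN; apply: nolb; exists j.+1%:R^-1.
    by rewrite invr_gt0 ltr0n.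
  exists N => // k /= Nk; rewrite leNgt; apply/negP => uk; apply: noN.
  by exists k.
apply: nocvg kk_incr _; apply/cvgr0Pnorm_le => e e0.
near=> j; rewrite ger0_norm //; apply: le_trans (ltW (kk_small j)) (ltW _).
near: j; exact: (near_infty_natSinv_lt (PosNum e0)).
Unshelve. all: by end_near. Qed.

Lemma eventually_le_of_not_subseq_cvgy (R : realType) (u : nat -> \bar R) :
  (forall kk, increasing_seq kk -> ~ (u (kk j) @[j --> \oo] --> +oo%E)) ->
  exists M : R, \forall k \near \oo, (u k <= M%:E)%E.
Proof.
move=> nocvg; apply: contrapT => noub.
have [j N|kk kk_incr kk_large] :=
    @extract_subsequence (fun j k => (j%:R%:E < u k)%E).
  apply: contrapT => noN; apply: noub; exists j%:R.
  exists N => // k /= Nk; rewrite leNgt; apply/negP => uk; apply: noN.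
  by exists k.
apply: nocvg kk_incr _; apply/cvgeyPge => A.
near=> j; apply: le_trans (ltW (kk_large j)); rewrite lee_fin.
near: j; exact: nbhs_infty_ger.
Unshelve. all: by end_near. Qed.
(** Along a sequence with u_(k+1) <= u_k - c alpha_k the decrements add up to
    c times a tail of the divergent series of the alpha_k. *)
Lemma cvgNy_of_step_decrease (R : realType) (u alpha : nat -> R) (c : R) :
  0 < c -> series alpha k @[k --> \oo] --> +oo ->
  (\forall k \near \oo, u k.+1 <= u k - c * alpha k) ->
  u k @[k --> \oo] --> -oo.
Proof.
move=> c0 alphay [N _ ustep].
have telescope d :
    u (N + d)%N <= u N - c * (series alpha (N + d)%N - series alpha N).
  elim: d => [|d IHd]; first by rewrite addn0 subrr mulr0 subr0.
  rewrite addnS; apply: le_trans (ustep _ (leq_addr _ _)) _.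
  by rewrite seriesSr; move: IHd; lra.
apply/cvgrNyPle => A; near=> k.
have Nk : (N <= k)%N by near: k; exact: nbhs_infty_ge.
have : (u N - A) / c + series alpha N <= series alpha k.
  by near: k; exact: (iffLR (cvgryPge _) alphay).
rewrite -lerBrDr ler_pdivrMr // mulrC => big.
by have := telescope (k - N)%N; rewrite subnKC //; move: big; lra.
Unshelve. all: by end_near. Qed.

End Sequences.

(** * Descent with approximate gradients *)

Section DescentStep.
Variables (R : realType) (n m : nat).

(** The vector 2 W is feasible for the estimates g: for the exact gradients it
    satisfies each constraint with a margin |G_i|, while replacing G_i by g_i
    costs at most c_i + 2 c_i M <= 3 c_i M <= |G_i|. *)
Lemma stale_minimizer_bounded (G g : 'I_m -> 'rV[R]_n) (c : 'I_m -> R) (M : R)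
    (W V : 'rV[R]_n) :
  1 <= M -> (forall i, 8 * M * c i <= enorm (G i)) ->
  (forall i, enorm (g i - G i) <= c i) ->
  central_cone G W -> enorm W <= M ->
  is_minimizer (fun U => enorm U ^+ 2) (central_cone g) V ->
  enorm V <= 2 * M.
Proof.
move=> M1 Gbig gG GW WM [_ Vmin].
suff /Vmin : central_cone g (2 *: W).
  rewrite ler_pXn2r ?nnegrE ?enorm_ge0 // => /le_trans; apply.
  by rewrite enormZ ger0_norm ?ler0n // ler_pM2l ?ltr0n.
move=> i; rewrite dotpZr.
have c0 : 0 <= c i := le_trans (enorm_ge0 _) (gG i).
have errW : dotp (g i - G i) W <= c i * M.
  apply: le_trans (dotp_le_enorm _ _) _.
  by apply: ler_pM; rewrite ?enorm_ge0.
have gi : enorm (g i) <= c i + enorm (G i).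
  rewrite -{1}(subrK (G i) (g i)); apply: le_trans (ler_enormD _ _) _.
  by rewrite lerD2r.
have cM : c i <= c i * M by rewrite ler_peMr.
move: errW; rewrite dotpBl; have := GW i; have := Gbig i.
by rewrite -mulrA [M * _]mulrC; lra.
Qed.

(** The slope along the step with respect to the estimate g is at most
    -|g| / (2 M) <= -(7/2) c, since |g| >= 8 M c - c >= 7 M c.  The error on the
    gradient and the second order term cost at most c each per unit length, so
    a decrease of at least c per unit length is left. *)
Lemma stale_step_decreases (h : 'rV[R]_n -> R) (L a c M : R)
    (y g V : 'rV[R]_n) :
  (forall z, differentiable h z) -> 0 <= L ->
  (forall z w, enorm (grad h z - grad h w) <= L * enorm (z - w)) ->
  0 < a -> L * a <= c -> 1 <= M -> 8 * M * c <= enorm (grad h y) ->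
  enorm (g - grad h y) <= c -> dotp g V <= - enorm g ->
  0 < enorm V -> enorm V <= 2 * M ->
  h (y + (a / enorm V) *: V) <= h y - c * a.
Proof.
move=> h_diff L0 h_lip a0 La M1 Gbig gG gV V0 VM.
have c0 : 0 <= c := le_trans (enorm_ge0 _) gG.
set s := _ *: V.
have sE : enorm s = a.
  by rewrite enormZ ger0_norm ?divr_ge0 ?ltW // divfK ?gt_eqF.
have gbig : 7 * M * c <= enorm g.
  have : enorm (grad h y) <= enorm g + c.
    rewrite -{1}(subrK g (grad h y)); apply: le_trans (ler_enormD _ _) _.
    by rewrite addrC lerD2l enormB.
  have cM : c <= M * c by rewrite ler_peMl.
  by move: Gbig; rewrite -!mulrA; lra.
have ca : 0 <= c * a by rewrite mulr_ge0 // ltW.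
have gs : dotp g s <= - (7 / 2 * c * a).
  rewrite dotpZr mulrAC ler_pdivrMr //.
  have : a * (7 * M * c) <= a * enorm g by rewrite ler_pM2l.
  have : a * dotp g V <= a * - enorm g by rewrite ler_pM2l.
  by have := ler_wpM2l ca VM; lra.
have errs : dotp (grad h y - g) s <= c * a.
  apply: le_trans (dotp_le_enorm _ _) _; rewrite sE enormB.
  by rewrite ler_wpM2r // ltW.
apply: le_trans (lipschitz_grad_step h_diff h_lip L0 y s) _.
have La2 : L * enorm s ^+ 2 <= c * a by rewrite sE expr2 mulrA ler_pM2r.
by move: errs; rewrite dotpBl; lra.
Qed.

End DescentStep.

(** * Staleness of the gradient estimates along a run *)

Section Run.
Variables (R : realType) (n m : nat).

Lemma drift_le (x : nat -> 'rV[R]_n) (eta : R) N :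
  (forall k, (N <= k)%N -> enorm (x k.+1 - x k) <= eta) ->
  forall k d, (N <= k)%N -> enorm (x (k + d)%N - x k) <= d%:R * eta.
Proof.
move=> xstep k d Nk; elim: d => [|d IHd].
  by rewrite addn0 subrr -(scale0r 0) enormZ normr0 !mul0r.
rewrite addnS -(subrKA (x (k + d)%N)) -natr1 mulrDl mul1r [leRHS]addrC.
apply: le_trans (ler_enormD _ _) (lerD _ IHd).
by apply: xstep; exact: leq_trans Nk (leq_addr _ _).
Qed.

Lemma cyclic_index_modn (t : nat -> 'I_m) :
  t 0%N = 0%N :> nat -> (forall k, t k.+1 = ordS (t k)) ->
  forall k, t k = (k %% m)%N :> nat.
Proof.
move=> t0 tS; elim=> [|k IHk]; first by rewrite mod0n.
by rewrite tS /= IHk -addn1 modnDml addn1.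
Qed.

Variables (f : 'I_m -> 'rV[R]_n -> R) (x : nat -> 'rV[R]_n).
Variables (g : nat -> 'I_m -> 'rV[R]_n) (t : nat -> 'I_m).
Hypothesis t0 : t 0%N = 0%N :> nat.
Hypothesis tS : forall k, t k.+1 = ordS (t k).
Hypothesis gS : forall k i,
  g k.+1 i = if i == t k then grad (f i) (x k) else g k i.

(** The first full cycle that begins after iteration k refreshes the i-th
    estimate before iteration k + 2m; later refreshes only make it more
    recent. *)
Lemma estimate_is_recent_grad i k :
  exists2 k', (k <= k' <= k + m.*2)%N & g (k + m.*2).+1 i = grad (f i) (x k').
Proof.
have m0 : (0 < m)%N by exact: leq_trans (ltn_ord i).
(* k0 is the iteration of the next full cycle that handles the index i. *)
pose k0 := ((k %/ m).+1 * m + i)%N.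
have tk0 : t k0 = i.
  by apply: val_inj; rewrite /= (cyclic_index_modn t0 tS) modnMDl modn_small.
have k_k0 : (k <= k0)%N.
  by apply: leq_trans (ltnW (ltn_ceil k m0)) (leq_addr _ _).
have k0_k : (k0 <= k + m.*2)%N.
  rewrite /k0 mulSn -addnn addnA [(k + m)%N]addnC leq_add ?(ltnW (ltn_ord i)) //.
  by rewrite leq_add2l leq_divM.
have persist d : exists2 k',
    (k0 <= k' <= k0 + d)%N & g (k0 + d).+1 i = grad (f i) (x k').
  elim: d => [|d [k' /andP[lo hi] E]].
    by exists k0; rewrite addn0 ?leqnn // gS tk0 eqxx.
  have [it|it] := eqVneq i (t (k0 + d.+1)%N).
    by exists (k0 + d.+1)%N; [rewrite leq_addr leqnn | rewrite gS it eqxx].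
  exists k'; first by rewrite lo addnS (leq_trans hi).
  by rewrite gS (negbTE it) addnS E.
have [k' /andP[lo hi]] := persist (k + m.*2 - k0)%N.
rewrite subnKC // in hi *; move=> E; exists k' => //.
by rewrite hi (leq_trans k_k0).
Qed.

Variables (L : R) (alpha : nat -> R).
Hypothesis L_ge0 : 0 <= L.
Hypothesis grad_lip : forall i y z,
  enorm (grad (f i) y - grad (f i) z) <= L * enorm (y - z).
Hypothesis alpha_cvg0 : alpha k @[k --> \oo] --> 0.
Hypothesis xstep : forall k, enorm (x k.+1 - x k) <= alpha k.

(** Between the evaluation of the estimate and its use there are at most 2m
    steps, so it suffices that each of them is at most delta / (2m L + 1). *)
Lemma estimate_error_vanishes i (delta : R) : 0 < delta ->
  \forall k \near \oo, enorm (g k.+1 i - grad (f i) (x k)) <= delta.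
Proof.
move=> delta0.
(* The summand 1 keeps the denominator positive when L = 0. *)
pose C : R := L * m.*2%:R + 1.
have C0 : 0 < C by rewrite ltr_wpDl // mulr_ge0.
have eta0 : 0 < delta / C by rewrite divr_gt0.
have /cvgr0Pnorm_le/(_ _ eta0)[N _ alpha_small] := alpha_cvg0.
exists (N + m.*2)%N => //= k Nk.
have {Nk} [l lk Nl] : exists2 l, (l + m.*2 = k)%N & (N <= l)%N.
  exists (k - m.*2)%N; first by rewrite subnK // (leq_trans _ Nk) // leq_addl.
  by rewrite leq_subRL ?(leq_trans _ Nk) ?leq_addl // addnC.
have [k' /andP[lk' k'k]] := estimate_is_recent_grad i l.
rewrite lk in k'k *; move=> ->.
apply: le_trans (grad_lip _ _ _) _; rewrite enormB.
have drift : enorm (x k - x k') <= (k - k')%:R * (delta / C).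
  rewrite -{1}(subnKC k'k); apply: (@drift_le _ _ N).
    move=> j Nj; apply: le_trans (xstep j) _.
    exact: le_trans (ler_norm _) (alpha_small j Nj).
  exact: leq_trans lk'.
apply: le_trans (ler_wpM2l L_ge0 drift) _.
rewrite [leLHS](_ : _ = delta * (L * (k - k')%:R / C)); last by ring.
rewrite ler_piMr ?(ltW delta0) // ler_pdivrMr // mul1r.
rewrite ler_wpDr // ler_wpM2l // ler_nat leq_subLR -lk.
by rewrite leq_add2r.
Qed.

End Run.

(** * Convergence of the algorithm *)

Theorem theorem3p1 (R : realType) (n m : nat) (f : 'I_m -> 'rV[R]_n -> R)
    (L : R) (alpha : nat -> R)
    (x1 : 'rV[R]_n) (g1 : 'I_m -> 'rV[R]_n) (x : nat -> 'rV[R]_n)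
    (f_diff : forall i y, differentiable (f i) y)
    (L_ge0 : 0 <= L)
    (grad_lip : forall i y z,
      enorm (grad (f i) y - grad (f i) z) <= L * enorm (y - z))
    (alpha_gt0 : forall k, 0 < alpha k)
    (alpha_cvg0 : alpha k @[k --> \oo] --> 0)
    (alpha_series : series alpha k @[k --> \oo] --> +oo)
    (g1_neq0 : forall i, g1 i != 0)
    (x_run : incremental_central_run f alpha x1 g1 x) :
  exists2 kk : nat -> nat, increasing_seq kk &
    [\/ exists i, enorm (grad (f i) (x (kk j))) @[j --> \oo] --> 0,
        central_dir_norm f (x (kk j)) @[j --> \oo] --> +oo%E |
        (forall i, f i (x (kk j)) @[j --> \oo] --> -oo) /\
        (forall i, ~ has_lbound (range (f i)))].
Proof.
case: x_run => g [t] [V] [_ _ t0 run].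
have tS k : t k.+1 = ordS (t k) by have [] := run k.
have gS k i : g k.+1 i = if i == t k then grad (f i) (x k) else g k i.
  by have [] := run k.
have Vmin k : is_minimizer (fun W => enorm W ^+ 2) (central_cone (g k.+1)) (V k).
  by have [] := run k.
have xS k : x k.+1 = x k + (alpha k / enorm (V k)) *: V k.
  by have [] := run k.
(* V k = 0 would force the estimate just refreshed to have norm 0. *)
have V_gt0 k : 0 < enorm (V k).
  have [_ gt_neq0 [feas _] _ _] := run k.
  rewrite enorm_gt0; apply/eqP => V0; have := feas (t k).
  rewrite V0 -(scale0r 0) dotpZr mul0r oppr_ge0 => /le_lt_trans h.
  by have := h _ (etrans (enorm_gt0 _) gt_neq0); rewrite ltxx.
have xstep k : enorm (x k.+1 - x k) <= alpha k.
  rewrite xS addrC addKr enormZ ger0_norm; last by rewrite divr_ge0 ?ltW.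
  by rewrite divfK ?gt_eqF.
apply: contrapT => no_subseq.
have grad_away i : exists2 eps, 0 < eps &
    \forall k \near \oo, eps <= enorm (grad (f i) (x k)).
  apply: eventually_ge_of_not_subseq_cvg0 => [k|kk kkI cvg0].
    exact: enorm_ge0.
  by apply: no_subseq; exists kk => //; constructor 1; exists i.
have [M0 dir_le] : exists M : R,
    \forall k \near \oo, (central_dir_norm f (x k) <= M%:E)%E.
  apply: (@eventually_le_of_not_subseq_cvgy _ (central_dir_norm f \o x)).
  by move=> kk kkI cvgy; apply: no_subseq; exists kk => //; constructor 2.
(* The upper bound is raised to 1 because the descent estimates absorb c into
   M c. *)
pose M := Num.max M0 1.
have M1 : 1 <= M by rewrite le_max lexx orbT.
have M_gt0 : 0 < M by exact: lt_le_trans M1.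
have /choice[c cP] i : exists c, 0 < c /\
    \forall k \near \oo, 8 * M * c <= enorm (grad (f i) (x k)).
  have [eps eps0 epsP] := grad_away i; exists (eps / (8 * M)).
  by rewrite divr_gt0 ?mulr_gt0 // mulrC divfK // gt_eqF ?mulr_gt0.
have grad_big : \forall k \near \oo,
    forall i, 8 * M * c i <= enorm (grad (f i) (x k)).
  by apply: filter_forall => i; exact: (cP i).2.
have err_small : \forall k \near \oo,
    forall i, enorm (g k.+1 i - grad (f i) (x k)) <= c i.
  apply: filter_forall => i.
  exact: (estimate_error_vanishes t0 tS gS L_ge0 grad_lip alpha_cvg0 xstep
    i (cP i).1).
have fNy i : f i (x k) @[k --> \oo] --> -oo.
  apply: (cvgNy_of_step_decrease (cP i).1 alpha_series).
  have c'0 : 0 < c i / (L + 1) by rewrite divr_gt0 ?(cP i).1 // ltr_wpDl.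
  near=> k; rewrite xS.
  have Lalpha : L * alpha k <= c i.
    have : `|alpha k| <= c i / (L + 1).
      by near: k; exact: (iffLR (cvgr0Pnorm_le _) alpha_cvg0 _ c'0).
    rewrite gtr0_norm // ler_pdivlMr ?ltr_wpDl //.
    by have := alpha_gt0 k; lra.
  have big : forall i, 8 * M * c i <= enorm (grad (f i) (x k)) by near: k.
  have small : forall i, enorm (g k.+1 i - grad (f i) (x k)) <= c i by near: k.
  have [|W Wcone WM] := @central_dir_norm_feasible _ _ _ f (x k) M.
    apply: le_trans (_ : (M0%:E <= M%:E)%E); first by near: k.
    by rewrite lee_fin le_max lexx.
  have V_le := stale_minimizer_bounded M1 big small Wcone WM (Vmin k).
  exact: (stale_step_decreases (f_diff i) L_ge0 (grad_lip i) (alpha_gt0 k)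
    Lalpha M1 (big i) (small i) ((Vmin k).1 i) (V_gt0 k) V_le).
apply: no_subseq; exists id => //; constructor 3; split=> // i [b fb].
have /cvgrNyPle/(_ (b - 1))[N _ /(_ N (leqnn N)) /= fN] := fNy i.
by have := fb _ (imageT (f i) (x N)); lra.
Unshelve. all: by end_near. Qed.
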